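(* Let $p$ be a binary word of length $l$ with at most $3$ runs. (1) If $p$ is alternating, then $p$ has no internal zero at any $n\ge7$. (2) If $p$ is not alternating, then for every $n\ge l+3$ we have $B_{n,p}(M_{n,p}-1)=0$, and in particular $p$ has an internal zero at every $n\ge l+3$. Moreover, among non-alternating $p$ with at most $3$ runs, $B_{l+2,p}(M_{l+2,p}-1)=0$ fails only for the words $p$ that are trivially equivalent to $1101$.
   Context: $c_p(w)$ is the number of occurrences of $p$ as a (not necessarily consecutive) subsequence of $w$; $B_{n,p}(k)$ is the number of binary words of length $n$ with $c_p(w)=k$; $M_{n,p}=\max\{c_p(w):w\in\{0,1\}^n\}$. A run is a maximal block of consecutive equal letters; a word is alternating if all its runs have size $1$. $p$ has an internal zero at $n$ if there exist $0\le k_1<k_2<k_3$ with $B_{n,p}(k_1)\ne0$, $B_{n,p}(k_2)=0$, $B_{n,p}(k_3)\ne0$. Words $p$ and $q$ are trivially equivalent if $q\in\{p,p^r,p^c,p^{rc}\}$, where $p^r$ is the reverse, $p^c$ is obtained by swapping $0\leftrightarrow1$, and $p^{rc}$ is the complement of the reverse. *)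

(* Defs.v *)
From mathcomp Require Import all_boot.
Set Implicit Arguments. Unset Strict Implicit. Unset Printing Implicit Defensive.

(* Binary words are sequences of booleans (false = 0, true = 1). *)

(* c_p(w): number of occurrences of p as a (not necessarily consecutive)
   subsequence of w, i.e. number of selections of positions of w
   (encoded as masks) whose selected letters spell p. *)
Definition occ (p w : seq bool) : nat :=
  #|[set m : (size w).-tuple bool | mask m w == p]|.

Definition B (n : nat) (p : seq bool) (k : nat) : nat :=
  #|[set w : n.-tuple bool | occ p w == k]|.

Definition M (n : nat) (p : seq bool) : nat :=
  \max_(w : n.-tuple bool) occ p w.

Fixpoint nruns (s : seq bool) : nat :=
  match s with
  | [::] => 0
  | x :: s' => match s' with
               | [::] => 1
               | y :: _ => (x != y) + nruns s'
               end
  end.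

Definition alternating (p : seq bool) : bool := sorted (fun a b => a != b) p.

Definition internal_zero (p : seq bool) (n : nat) : Prop :=
  exists k1 k2 k3, [/\ k1 < k2, k2 < k3, B n p k1 != 0, B n p k2 = 0 & B n p k3 != 0].

Definition triv_equiv (p q : seq bool) : bool :=
  q \in [:: p; rev p; map negb p; rev (map negb p)].

(* Main.v *)
Require Import Defs.
From mathcomp Require Import all_boot.
From mathcomp Require Import zify.

Set Implicit Arguments. Unset Strict Implicit. Unset Printing Implicit Defensive.

(* Up to complement [p = 1^a 0^b 1^c].  An occurrence of [p] in [w] chooses [b]
   zeros of [w]; if the first and the last of them have [x] and [y] of the [m]
   ones of [w] to their left, the choice extends in [C(x,a) C(m-y,c)] ways.
   Hence block words [1^i 0^j 1^k] are optimal, and a word that is not optimal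
   for its numbers of letters loses at least 2, unless it is a small exception
   that a block word with other numbers of letters beats by at least 2; for
   [1101] and [1011] at length 6 this last comparison fails.  So only block
   words could reach [M - 1], i.e. one would have
   [C(i,a) C(j,b) C(k,c) = M - 1].  By log-concavity this product reaches its
   maximum along shifts of one unit that never decrease it, and a shift that
   gains exactly 1 forces [i + j + k = a + b + c + 1] or [p] alternating.

   For [p = 101] a word has [sum_z x_z (m - x_z)] occurrences, [z] ranging over
   its zeros.  With [m = 2q] this is [j q^2] minus a sum of [j] squares, and
   every [D < q^2] is a sum of few squares, which covers the values between
   consecutive maxima. *)

(** * Moving one unit between two binomial coefficients *)

Lemma exchange_binS a b m k :
  'C(m, a.+1) * 'C(k.+1, b.+1) + 'C(m, a) * 'C(k, b.+1) =
  'C(m.+1, a.+1) * 'C(k, b.+1) + 'C(m, a.+1) * 'C(k, b).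
Proof. rewrite !binS; lia. Qed.

(** After [exchange_binS] only [C(m,a) C(k,b+1)] and [C(m,a+1) C(k,b)] remain to be compared; they
    are [C(m,a) C(k,b)] times the ratios [(k-b)/(b+1)] and [(m-a)/(a+1)]. The criterion is monotone
    in each of [m] and [k], which is the form of log-concavity used below. *)
Lemma exchange_leq a b m k : a <= m -> b <= k ->
  ('C(m.+1, a.+1) * 'C(k, b.+1) <= 'C(m, a.+1) * 'C(k.+1, b.+1)) =
  (a.+1 * (k - b) <= b.+1 * (m - a)).
Proof.
move=> ham hbk; have E := exchange_binS a b m k.
have -> : ('C(m.+1, a.+1) * 'C(k, b.+1) <= 'C(m, a.+1) * 'C(k.+1, b.+1)) =
          ('C(m, a) * 'C(k, b.+1) <= 'C(m, a.+1) * 'C(k, b)) by lia.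
have hu : 0 < 'C(m, a) by rewrite bin_gt0.
have hv : 0 < 'C(k, b) by rewrite bin_gt0.
have E1 := mul_bin_left k b; have E2 := mul_bin_left m a.
rewrite -(@leq_pmul2l (a.+1 * b.+1)) //.
have -> : a.+1 * b.+1 * ('C(m, a) * 'C(k, b.+1)) =
          'C(m, a) * 'C(k, b) * (a.+1 * (k - b)) by rewrite mulnACA E1; lia.
have -> : a.+1 * b.+1 * ('C(m, a.+1) * 'C(k, b)) =
          'C(m, a) * 'C(k, b) * (b.+1 * (m - a)) by rewrite mulnACA E2; lia.
by rewrite leq_pmul2l // muln_gt0 hu.
Qed.

Lemma bin_add2 n : 'C(n.+2, n) = 'C(n.+2, 2).
Proof. by rewrite -(@bin_sub n.+2 2) // !subSS subn0. Qed.

(** For [a > 0] and [m >= a+2], already [C(a+2,a) = (a+2)(a+1)/2] exceeds [a+1]. The equality cases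
    are what [exchange_succ] turns on. *)
Lemma bin_pred_leq a m : a < m -> a.+1 <= 'C(m, a) ?= iff (m == a.+1) || (a == 0).
Proof.
move=> ham; split.
  by rewrite -[X in X <= _](binSn a) leq_bin2l.
apply/idP/idP; last by case/orP=> /eqP ->; rewrite ?binSn ?bin0.
case: a ham => [|a] ham; first by rewrite orbT.
case: (m =P a.+2) => //= ne h; exfalso.
have : 'C(a.+3, a.+1) <= 'C(m, a.+1) by apply: leq_bin2l; lia.
by rewrite -(eqP h) bin_add2 bin2 /=; lia.
Qed.

(* With [u = C(m,a)] and [v = C(k,b)] the difference of the two sides is
   [u v N / ((a+1)(b+1))] for an integer [N], while [u > a] and [v > b]. *)
Lemma exchange_succ a b m k : a < m -> b < k ->
  'C(m.+1, a.+1) * 'C(k, b.+1) + 1 = 'C(m, a.+1) * 'C(k.+1, b.+1) ->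
  m = a.+1 /\ k = b.+1 \/ a = 0 /\ b = 0.
Proof.
move=> ham hbk hD; have E := exchange_binS a b m k.
have [hu eu] := bin_pred_leq ham; have [hv ev] := bin_pred_leq hbk.
have E1 := mul_bin_left k b; have E2 := mul_bin_left m a.
have {}hD : 'C(m, a) * 'C(k, b.+1) + 1 = 'C(m, a.+1) * 'C(k, b) by lia.
have hD' : 'C(m, a) * 'C(k, b) * (a.+1 * (k - b)) + a.+1 * b.+1 =
           'C(m, a) * 'C(k, b) * (b.+1 * (m - a)).
  have -> : 'C(m, a) * 'C(k, b) * (b.+1 * (m - a)) = a.+1 * b.+1 * ('C(m, a.+1) * 'C(k, b)).
    by rewrite [RHS]mulnACA E2; lia.
  rewrite -hD mulnDr [a.+1 * b.+1 * ('C(_, _) * _)]mulnACA E1; lia.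
have hL : a.+1 * b.+1 <= 'C(m, a) * 'C(k, b) by apply: leq_mul.
have hP0 : 0 < 'C(m, a) * 'C(k, b) by apply: leq_trans hL.
have hlt : a.+1 * (k - b) < b.+1 * (m - a) by rewrite -(ltn_pmul2l hP0); lia.
have [N hN] : exists N, b.+1 * (m - a) = a.+1 * (k - b) + N.+1.
  by exists (b.+1 * (m - a) - a.+1 * (k - b)).-1; lia.
have hP : 'C(m, a) * 'C(k, b) * N.+1 = a.+1 * b.+1.
  by move: hD'; rewrite hN mulnDr; lia.
have {hD' hlt hL}hN0 : N = 0.
  move: hP hL hP0; rewrite mulnS; set P := 'C(m, a) * 'C(k, b).
  by case: N {hN} => // N; rewrite mulnS; lia.
move: hP; rewrite hN0 muln1 => hP.
have hua : a.+1 = 'C(m, a).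
  apply/eqP; rewrite eqn_leq hu leqNgt; apply/negP => lt.
  have := leq_mul lt hv; rewrite hP mulSn; lia.
have hvb : b.+1 = 'C(k, b).
  by move: hP; rewrite -hua => /eqP; rewrite eqn_pmul2l // => /eqP ->.
move: eu ev hN; rewrite hN0 -hua -hvb !eqxx => /esym /orP hm /esym /orP hk.
clear E E1 E2 hD hP hP0 hu hv hua hvb.
(* The two mixed equality cases either contradict [hN] or reduce to one of the two conclusions. *)
case: hm => /eqP ?; case: hk => /eqP ?; subst; try lia; nia.
Qed.

(** * Products of binomials under unit shifts *)

(** With three indices this counts the occurrences of [1^a 0^b 1^c] in a block word; an arbitrary
    index type lets patterns with two and with three runs share one argument. *)
Definition binprod (I : finType) (p x : I -> nat) := \prod_i 'C(x i, p i).

Definition shift (I : finType) (s t : I) (x : I -> nat) : I -> nat :=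
  fun i => if i == s then (x i).-1 else if i == t then (x i).+1 else x i.

Lemma sum_split2 (I : finType) (s t : I) (x : I -> nat) : s != t ->
  \sum_i x i = x s + x t + \sum_(i | (i != s) && (i != t)) x i.
Proof.
move=> st; rewrite (bigD1 s) //= (bigD1 t) /= ?addnA //; by rewrite eq_sym.
Qed.

Lemma binprod_split2 (I : finType) (s t : I) (p x : I -> nat) : s != t ->
  binprod p x = 'C(x s, p s) * 'C(x t, p t) *
                \prod_(i | (i != s) && (i != t)) 'C(x i, p i).
Proof.
move=> st; rewrite /binprod (bigD1 s) //= (bigD1 t) /= ?mulnA //; by rewrite eq_sym.
Qed.

Lemma shift_src (I : finType) (s t : I) x : shift s t x s = (x s).-1.
Proof. by rewrite /shift eqxx. Qed.

Lemma shift_tgt (I : finType) (s t : I) x : s != t -> shift s t x t = (x t).+1.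
Proof. by rewrite /shift eq_sym eqxx => /negbTE ->. Qed.

Lemma shift_other (I : finType) (s t i : I) x : i != s -> i != t -> shift s t x i = x i.
Proof. by rewrite /shift => /negbTE -> /negbTE ->. Qed.

Lemma sum_shift (I : finType) (s t : I) x : s != t -> 0 < x s ->
  \sum_i shift s t x i = \sum_i x i.
Proof.
move=> st xs; rewrite !(sum_split2 _ st) shift_src shift_tgt //.
rewrite (eq_bigr x); first by lia.
by move=> i /andP[? ?]; rewrite shift_other.
Qed.

Lemma binprod_shift (I : finType) (s t : I) (p x : I -> nat) : s != t ->
  binprod p (shift s t x) = 'C((x s).-1, p s) * 'C((x t).+1, p t) *
                \prod_(i | (i != s) && (i != t)) 'C(x i, p i).
Proof.
move=> st; rewrite (binprod_split2 _ _ st) shift_src shift_tgt //; congr (_ * _).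
by apply: eq_bigr => i /andP[? ?]; rewrite shift_other.
Qed.

Lemma binprod_gt0 (I : finType) (p x : I -> nat) :
  (0 < binprod p x) = [forall i, p i <= x i].
Proof.
rewrite /binprod; apply/idP/forallP.
  move=> h i; move: h; rewrite (bigD1 i) //= muln_gt0 => /andP[].
  by rewrite bin_gt0.
by move=> h; apply: prodn_cond_gt0 => i _; rewrite bin_gt0.
Qed.

(** All the excess goes to [i0], and [C(q+d,q) >= C(q+2,2) >= 3] for [q = p i0] and [d >= 2]. Hence
    a vector one below the maximum still has a nonzero product. *)
Lemma leq_binprod_gt2 (I : finType) (p : I -> nat) n (i0 : I) : (0 < p i0) ->
  \sum_i p i + 2 <= n -> exists z, \sum_i z i = n /\ 2 < binprod p z.
Proof.
move=> hp hn; pose d := n - \sum_i p i.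
exists (fun i => if i == i0 then p i + d else p i); split.
  rewrite (bigD1 i0) //= eqxx (eq_bigr p); last by move=> i /negbTE ->.
  have := erefl (\sum_i p i); rewrite {1}(bigD1 i0) //=; lia.
rewrite /binprod (bigD1 i0) //= eqxx big1; last first.
  by move=> i /negbTE ->; rewrite binn.
have : 'C(p i0 + 2, p i0) <= 'C(p i0 + d, p i0) by apply: leq_bin2l; lia.
rewrite addn2 bin_add2 bin2 /=.
case: (p i0) hp => // q _; rewrite muln1; nia.
Qed.

Lemma bin_eq1 n k : 0 < k -> 'C(n, k) = 1 -> n = k.
Proof.
move=> hk h; have hkn : k <= n by rewrite -bin_gt0 h.
apply/eqP; rewrite eqn_leq hkn andbT leqNgt; apply/negP => lt.
have : 'C(k.+1, k) <= 'C(n, k) by exact: leq_bin2l.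
by rewrite binSn h; lia.
Qed.

Lemma prod_bin_eq1 (I : finType) (P : pred I) (p x : I -> nat) :
  (forall i, 0 < p i) -> \prod_(i | P i) 'C(x i, p i) = 1 ->
  forall i, P i -> x i = p i.
Proof.
move=> hp h i Pi; apply: bin_eq1 => //.
by move: h; rewrite (bigD1 i) //= => /eqP; rewrite muln_eq1 => /andP[/eqP].
Qed.

(** The untouched coordinates contribute a common factor [R] dividing both products, hence their
    difference 1, so these coordinates are tight. The first case of [exchange_succ] then makes the
    total [\sum_i p i + 1], which is too small. In the second [p s = p t = 1], and moving the unit
    to a coordinate [r] with [1 < p r] instead breaks the assumed bound. *)
Lemma binprod_shift_neq (I : finType) (p x : I -> nat) (s t : I) n : s != t ->
  (forall i, 0 < p i) -> (exists i, 1 < p i) ->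
  \sum_i p i + 2 <= n -> \sum_i x i = n -> 0 < binprod p x ->
  (forall z, \sum_i z i = n -> binprod p z <= binprod p x + 1) ->
  binprod p (shift s t x) <> binprod p x + 1.
Proof.
move=> st hp [r hr] hpn hxn hx0 hmax.
have hge i : p i <= x i by move: hx0; rewrite binprod_gt0 => /forallP.
rewrite binprod_shift // (binprod_split2 _ _ st); set R := \prod_(i | _) _ => hD.
have hR : R = 1.
  by apply/eqP; rewrite -dvdn1
    -(dvdn_addr _ (dvdn_mull ('C(x s, p s) * 'C(x t, p t)) (dvdnn R))) -hD dvdn_mull.
have hoth i : i != s -> i != t -> x i = p i.
  by move=> h1 h2; apply: (prod_bin_eq1 hp hR); rewrite h1.
have [xs hxs] : exists m, x s = m.+1.
  by exists (x s).-1; have := hp s; have := hge s; lia.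
have [a ha] : exists a, p s = a.+1 by exists (p s).-1; have := hp s; lia.
have [b hb] : exists b, p t = b.+1 by exists (p t).-1; have := hp t; lia.
move: hD; rewrite hR !muln1 hxs ha hb /= => /esym hD.
have hgs := hge s; have hgt := hge t.
have lta : a < xs.
  rewrite ltnNge; apply/negP => le; move: hD.
  by rewrite (@bin_small xs a.+1) ?ltnS // mul0n; lia.
have ltb : b < x t by lia.
case: (exchange_succ lta ltb hD) => -[e1 e2].
  move: hxn hpn; rewrite !(sum_split2 _ st).
  rewrite (eq_bigr p); last by move=> i /andP[? ?]; apply: hoth.
  lia.
subst a b.
have rs : r != s by apply/eqP => ?; subst r; lia.
have rt : r != t by apply/eqP => ?; subst r; lia.
have sr : s != r by rewrite eq_sym.
have := hmax (shift s r x).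
rewrite sum_shift // ?hxs // => /(_ hxn).
rewrite binprod_shift // (binprod_split2 _ _ st) -/R hR hxs ha hb hoth //= binSn.
rewrite (bigD1 t) /=; last by rewrite eq_sym st eq_sym.
rewrite (eq_bigl (fun i => [&& i != s, i != t & i != r])); last first.
  by move=> i; case: (i == s) (i == t) (i == r) => [] [] [].
rewrite big1; last first.
  by move=> i /and3P[? ? ?]; rewrite hoth // binn.
move: hD; rewrite hb !bin1; nia.
Qed.

(* Exchange argument: a unit moved from a coordinate where [x] exceeds the
   maximiser [y] to one where it falls short does not decrease [binprod], by
   log-concavity. Hence a path from [x] to [y] leaves the level [max - 1] by a
   single shift. *)
Lemma binprod_neq_pred_max (I : finType) (p x y : I -> nat) n :
  (forall i, 0 < p i) -> (exists i, 1 < p i) -> \sum_i p i + 2 <= n ->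
  \sum_i x i = n -> \sum_i y i = n ->
  (forall z, \sum_i z i = n -> binprod p z <= binprod p y) ->
  binprod p x + 1 <> binprod p y.
Proof.
move=> hp hp2 hpn hxn hyn hmax.
have [N hN] := ubnP (\sum_i (x i - y i)).
elim: N x hxn hN => // N IH x hxn hN hxy.
have hy0 : 0 < binprod p y by lia.
have hx0 : 0 < binprod p x.
  have [i0 hi0] := hp2; have [z [hz1 hz2]] := leq_binprod_gt2 (hp i0) hpn.
  by have := hmax z hz1; lia.
have hgx i : p i <= x i by move: hx0; rewrite binprod_gt0 => /forallP.
have hgy i : p i <= y i by move: hy0; rewrite binprod_gt0 => /forallP.
have [s hs] : exists s, y s < x s.
  case: (pickP (fun s => y s < x s)) => [s h|h]; first by exists s.
  have le i : x i <= y i by rewrite leqNgt h.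
  have /eqP hE : \sum_i x i == \sum_i y i by rewrite hxn hyn.
  have eq : forall i, true -> x i == y i.
    by apply/forall_inP; rewrite -(leqif_sum (fun i _ => leqif_eq (le i))) hE.
  by move: hxy; rewrite /binprod (eq_bigr (fun i => 'C(y i, p i))) => [|i _];
     [lia | rewrite (eqP (eq i isT))].
have [t ht] : exists t, x t < y t.
  case: (pickP (fun t => x t < y t)) => [t h|h]; first by exists t.
  have : \sum_i y i < \sum_i x i.
    rewrite (bigD1 s) //= [X in _ < X](bigD1 s) //=.
    have : \sum_(i | i != s) y i <= \sum_(i | i != s) x i.
      by apply: leq_sum => i _; rewrite leqNgt h.
    lia.
  by rewrite hxn hyn ltnn.
have st : s != t by apply/eqP => ?; subst t; lia.
have ts : t != s by rewrite eq_sym.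
have hle : binprod p x <= binprod p (shift s t x).
  have := hmax (shift t s y).
  rewrite sum_shift // ?hyn; last by lia.
  move=> /(_ erefl).
  rewrite (binprod_split2 _ y ts) (binprod_shift _ y ts).
  rewrite leq_pmul2r; last first.
    by apply: prodn_cond_gt0 => i _; rewrite bin_gt0.
  rewrite (binprod_split2 _ x st) (binprod_shift _ x st) => hyy.
  rewrite leq_mul2r; apply/orP; right.
  have := hp s; have := hp t; have := hgx s; have := hgx t; have := hgy s; have := hgy t.
  move: hyy hs ht.
  case: (p s) => // a; case: (p t) => // b.
  case: (x s) => // X; case: (y t) => // Y /=.
  move=> hyy h1 h2 h3 h4 h5 h6 _ _.
  (* Both comparisons become linear; since [y s < x s] and [x t < y t], the one for [y] implies the
     one for [x]. *)
  move: hyy; rewrite mulnC [leqRHS]mulnC exchange_leq; try lia.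
  rewrite exchange_leq; try lia.
  move: h1 h2 h3 h4 h5 h6; set ys := y s; set xt := x t; clear => *.
  nia.
have hxs0 : 0 < x s by lia.
have := @binprod_shift_neq I p x s t n st hp hp2 hpn hxn hx0.
rewrite hxy => /(_ hmax) hne.
have hmx := hmax (shift s t x).
rewrite sum_shift // hxn in hmx.
(* The shifted vector gains neither a negative amount nor exactly 1, so it is again one below the
   maximum, and it is closer to [y]. *)
apply: (IH (shift s t x)); rewrite ?sum_shift //; last by have := hmx erefl; lia.
have : \sum_i (shift s t x i - y i) < \sum_i (x i - y i); last by lia.
rewrite (sum_split2 (fun i => shift s t x i - y i) st) (sum_split2 (fun i => x i - y i) st).
rewrite shift_src shift_tgt // (eq_bigr (fun i => x i - y i)); first by lia.
by move=> i /andP[? ?]; rewrite shift_other.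
Qed.

(** * Counting occurrences by recursion on the word *)

Fixpoint cnt (p w : seq bool) : nat :=
  match w with
  | [::] => p == [::]
  | y :: w' => cnt p w' + (if p is x :: p' then (x == y) * cnt p' w' else 0)
  end.

Lemma sum_tuple0 (F : 0.-tuple bool -> nat) : \sum_(m : 0.-tuple bool) F m = F [tuple].
Proof.
by rewrite (big_pred1 [tuple]) // => m; rewrite [m]tuple0 /= eqxx.
Qed.

Lemma sum_tupleS n (F : n.+1.-tuple bool -> nat) :
  \sum_(m : n.+1.-tuple bool) F m =
  \sum_(m : n.-tuple bool) F (cons_tuple false m) +
  \sum_(m : n.-tuple bool) F (cons_tuple true m).
Proof.
pose h (x : bool * n.-tuple bool) := cons_tuple x.1 x.2.
rewrite (reindex h) /=; last first.
  exists (fun t => (thead t, [tuple of behead t])) => [[b t] _|t _].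
    by congr pair; apply: val_inj.
  by rewrite [RHS]tuple_eta; apply: val_inj.
rewrite -(pair_bigA _ (fun b t => F (h (b, t)))) /=.
by rewrite big_bool addnC.
Qed.

(** The masks split by their first bit: [false] skips the first letter of the word, [true] matches
    it with the first letter of the pattern. *)
Lemma occE p w : occ p w = cnt p w.
Proof.
have occ_sum q v : occ q v = \sum_(m : (size v).-tuple bool) (mask m v == q).
  by rewrite /occ cardsE -sum1_card big_mkcond.
elim: w p => [|y w IH] p; rewrite occ_sum /=.
  by rewrite sum_tuple0 eq_sym.
rewrite sum_tupleS /= -[cnt p w]IH occ_sum; congr (_ + _).
case: p => [|x p]; first by apply: big1 => m _.
rewrite -IH occ_sum big_distrr /=; apply: eq_bigr => m _.
by rewrite eqseq_cons eq_sym mulnb.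
Qed.

Lemma cnt_map_negb p w : cnt (map negb p) (map negb w) = cnt p w.
Proof.
elim: w p => [|y w IH] [|x p] //=; first by rewrite (IH [::]).
by rewrite (IH (x :: p)) IH (inj_eq negb_inj).
Qed.

Lemma cnt_nil w : cnt [::] w = 1.
Proof. by elim: w => //= y w ->. Qed.

Lemma cnt_nseq a x w : cnt (nseq a x) w = 'C(count_mem x w, a).
Proof.
elim: w a => [|y w IH] [|a] //=; rewrite ?cnt_nil ?bin0 //.
rewrite (IH a.+1) (IH a) [x == y]eq_sym.
by case: (y == x); rewrite ?add0n ?addn0 // mul1n add1n binS.
Qed.

Lemma cnt_skip x p w : x \notin w -> cnt (x :: p) w = 0.
Proof.
elim: w => //= y w IH; rewrite inE negb_or => /andP[/negbTE -> /IH ->] //.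
Qed.

(** * Occurrences as selections of zeros *)

(** Selections are made by position, so equal entries of [s] give repeated lists and sums over
    [combs] count with multiplicity. *)
Fixpoint combs (T : Type) (b : nat) (s : seq T) : seq (seq T) :=
  match b, s with
  | 0, _ => [:: [::]]
  | _.+1, [::] => [::]
  | b'.+1, x :: s' => map (cons x) (combs b' s') ++ combs b s'
  end.

Lemma combs0 T (s : seq T) : combs 0 s = [:: [::]].
Proof. by case: s. Qed.

Lemma size_combs T b (s : seq T) : size (combs b s) = 'C(size s, b).
Proof.
elim: s b => [|x s IH] [|b] //=.
by rewrite size_cat size_map !IH binS addnC.
Qed.

(* The word is read from left to right; [x] counts the ones already read. *)
Fixpoint zpos (x : nat) (w : seq bool) : seq nat :=
  match w with
  | [::] => [::]
  | y :: w' => if y then zpos x.+1 w' else x :: zpos x w'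
  end.

Lemma size_zpos x w : size (zpos x w) = count_mem false w.
Proof. by elim: w x => //= -[] w IH x //=; rewrite IH. Qed.

Lemma zpos_bounds x w :
  all (fun z => x <= z <= x + count_mem true w) (zpos x w).
Proof.
elim: w x => //= -[] w IH x /=.
  by apply: sub_all (IH x.+1) => z; lia.
rewrite leqnn leq_addr /=; apply: sub_all (IH x) => z; lia.
Qed.

Lemma zpos_sorted x w : sorted leq (zpos x w).
Proof.
elim: w x => //= -[] w IH x //=.
rewrite path_sortedE; last exact: leq_trans.
rewrite IH andbT; apply: sub_all (zpos_bounds x w) => z; lia.
Qed.

Lemma zpos_cat x u v :
  zpos x (u ++ v) = zpos x u ++ zpos (x + count_mem true u) v.
Proof.
elim: u x => [|[] u IH] x /=; rewrite ?addn0 // IH ?add0n //.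
by rewrite addSnnS.
Qed.

Lemma zpos_nseq x n b : zpos x (nseq n b) = if b then [::] else nseq n x.
Proof. by case: b; elim: n x => //= n IH x; rewrite IH. Qed.

Lemma last_combs (T : eqType) b (s : seq T) (x y : T) ys : 0 < b ->
  ys \in combs b s -> last x ys = last y ys.
Proof.
case: b => // b _; elim: s => //= z s IH; rewrite mem_cat => /orP[|/IH //].
by case/mapP => zs _ ->.
Qed.

(** The final ones come from those to the right of the last chosen zero. The default [x] of [last]
    matters for [b = 0]: no zero is chosen, and all ones of [w] are available. *)
Lemma cnt_zeros_ones b c x w :
  cnt (nseq b false ++ nseq c true) w =
  \sum_(ys <- combs b (zpos x w)) 'C(x + count_mem true w - last x ys, c).
Proof.
elim: w x b => [|y w IH] x [|b].
- by rewrite combs0 big_seq1 /= ?addn0 ?addKn ?subnn; case: c.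
- by rewrite big_nil.
- by rewrite combs0 big_seq1 [last _ _]/= addKn [nseq 0 _ ++ _]/= cnt_nseq.
case: y => /=.
  rewrite mul0n addn0 add1n -addSnnS; etransitivity; first exact: (IH x.+1 b.+1).
  by apply: eq_big_seq => ys /(last_combs x x.+1) ->.
rewrite mul1n add0n big_cat big_map /= addnC; congr (_ + _); last exact: (IH x b.+1).
exact: IH.
Qed.

(** The displayed zero is the first one of the word. An occurrence either avoids it or uses it as
    its first zero, and then the [a] ones come from the prefix. *)
Lemma cnt_ones_prefix a b c x w :
  cnt (nseq a true ++ nseq b.+1 false ++ nseq c true) (nseq x true ++ false :: w) =
  cnt (nseq a true ++ nseq b.+1 false ++ nseq c true) (nseq x true ++ w) +
  'C(x, a) * cnt (nseq b false ++ nseq c true) w.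
Proof.
elim: x a => [|x IH] [|a] //=; rewrite ?mul1n ?mul0n //.
- by have := IH 0; rewrite bin0 mul1n !addn0.
have := IH a.+1; have := IH a; rewrite binS mulnDl /=; lia.
Qed.

Definition ends_weight a c m (ys : seq nat) := 'C(head 0 ys, a) * 'C(m - last 0 ys, c).

(** The prefix of [x] ones is the part already read; keeping it in the word makes the induction on
    [w] go through. *)
Lemma cnt_runs_prefix a b c x w :
  cnt (nseq a true ++ nseq b.+1 false ++ nseq c true) (nseq x true ++ w) =
  \sum_(ys <- combs b.+1 (zpos x w)) ends_weight a c (x + count_mem true w) ys.
Proof.
elim: w x => [|y w IH] x.
  rewrite cats0 big_nil; elim: x a => [|x IHx] [|a] //=; rewrite ?mul0n ?addn0.
    by rewrite (IHx 0).
  by rewrite mul1n (IHx a) (IHx a.+1).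
case: y => /=.
  have -> : nseq x true ++ true :: w = nseq x.+1 true ++ w.
    by elim: (x) => //= n ->.
  by rewrite IH add1n addSnnS.
rewrite cnt_ones_prefix IH big_cat big_map /= add0n addnC; congr (_ + _).
by rewrite (cnt_zeros_ones _ _ x) big_distrr.
Qed.

Lemma cnt_runs a b c w :
  cnt (nseq a true ++ nseq b.+1 false ++ nseq c true) w =
  \sum_(ys <- combs b.+1 (zpos 0 w)) ends_weight a c (count_mem true w) ys.
Proof. exact: (cnt_runs_prefix a b c 0 w). Qed.

Lemma combs_nseq T b k (x : T) : combs b (nseq k x) = nseq 'C(k, b) (nseq b x).
Proof.
elim: k b => [|k IH] [|b] //=.
by rewrite !IH map_nseq /= -nseqD binS addnC.
Qed.

Lemma sum_combs_constant a b c m k x :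
  \sum_(ys <- combs b.+1 (nseq k x)) ends_weight a c m ys =
  'C(x, a) * 'C(k, b.+1) * 'C(m - x, c).
Proof.
rewrite combs_nseq big_nseq iter_addn_0 /ends_weight /=.
have -> : last x (nseq b x) = x by elim: b.
lia.
Qed.

Lemma cnt_block a b c i j k :
  cnt (nseq a true ++ nseq b.+1 false ++ nseq c true)
      (nseq i true ++ nseq j false ++ nseq k true) =
  'C(i, a) * 'C(j, b.+1) * 'C(k, c).
Proof.
rewrite cnt_runs_prefix zpos_cat !zpos_nseq cats0 sum_combs_constant.
by rewrite count_cat !count_nseq /= mul0n mul1n add0n addKn.
Qed.

(** * The loss of words that are not block words *)

Lemma ltn_bin n m k : n < m -> 0 < k <= m -> 'C(n, k) < 'C(m, k).
Proof.
case: m k => // m [//|k] nm km; rewrite binS.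
have : 'C(n, k.+1) <= 'C(m, k.+1) by apply: leq_bin2l.
have : 0 < 'C(m, k) by rewrite bin_gt0; lia.
lia.
Qed.

Lemma combsS T b x (s : seq T) :
  combs b.+1 (x :: s) = map (cons x) (combs b s) ++ combs b.+1 s.
Proof. by []. Qed.

Lemma mem_combs (T : eqType) b (s ys : seq T) :
  (ys \in combs b s) = subseq ys s && (size ys == b).
Proof.
elim: s b ys => [|x s IH] [|b] [|y ys] //=; rewrite ?mem_cat ?sub0seq ?andbF //.
  apply/negbTE; rewrite negb_or IH /= andbF andbT.
  by apply/negP => /mapP[].
rewrite IH /= eqSS; case: (y =P x) => [->|ne].
  rewrite mem_map; last by move=> ? ? [].
  rewrite IH; case: (_ == b) => /=; rewrite ?andbF // !andbT.
  by apply/orb_idr => /cons_subseq.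
by rewrite orb_idl // => /mapP[? _ []].
Qed.

Lemma combs1 T (s : seq T) : combs 1 s = [seq [:: x] | x <- s].
Proof. by elim: s => //= x s ->; rewrite combs0. Qed.

Lemma sum_loss (T : eqType) (s : seq T) (g : T -> nat) (P : pred T) f :
  {in s, forall y, g y + P y <= f} ->
  \sum_(y <- s) g y + count P s <= size s * f.
Proof.
elim: s => [|y s IH] h /=; first by rewrite big_nil.
rewrite big_cons mulSn; have := h y (mem_head _ _).
have : \sum_(y <- s) g y + count P s <= size s * f.
  by apply: IH => z zs; apply: h; rewrite inE zs orbT.
lia.
Qed.

(** For positions given by [zpos], this says that a one lies between the first and the last of the
    zeros. *)
Definition straddles (ys : seq nat) := head 0 ys < last 0 ys.

Lemma sorted_head_last (x : nat) s : sorted leq (x :: s) -> x <= last x s.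
Proof.
move=> /= /(order_path_min leq_trans) /allP h.
by case/lastP: s h => // s y h; rewrite last_rcons h // mem_rcons mem_head.
Qed.

(** If the tail straddles and has more than [b] entries, induction applies; with exactly [b]
    entries, the tail is one such selection, and replacing its head by [x] gives another. If the
    tail is constant, every selection through [x] straddles, and there are at least two. *)
Lemma count_straddles b s : 1 < b -> b < size s -> sorted leq s -> straddles s ->
  1 < count straddles (combs b s).
Proof.
case: b => [|[|b]] // _.
elim: s => [|x [|y s] IH] // hb srt str.
rewrite combsS count_cat count_map.
have srt' : sorted leq (y :: s) by case/andP: srt.
have xy : x <= y by case/andP: srt.
have yl := sorted_head_last srt'.
have [yltl|lley] := ltnP y (last y s).
  have [lt|ge] := ltnP b.+2 (size (y :: s)).
    by apply: leq_trans (IH lt srt' yltl) (leq_addl _ _).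
  have eb : size s = b.+1 by move: hb ge => /=; lia.
  have h1 : 0 < count straddles (combs b.+2 (y :: s)).
    rewrite -has_count; apply/hasP; exists (y :: s) => //.
    by rewrite mem_combs subseq_refl /= eb eqxx.
  have h2 : 0 < count (preim (cons x) straddles) (combs b.+1 (y :: s)).
    rewrite -has_count; apply/hasP; exists s.
      by rewrite mem_combs subseq_cons eb eqxx.
    case: s eb {IH hb str srt srt' yl ge h1} yltl => // z s _ /=.
    by rewrite /straddles /=; lia.
  by rewrite -[2]/(1 + 1); apply: leq_add.
have xlty : x < y by move: str; rewrite /straddles /=; lia.
apply: leq_trans (leq_addr _ _).
rewrite (eq_in_count (a2 := predT)) ?count_predT ?size_combs.
  have [h _] := @bin_pred_leq b.+1 (size (y :: s)) hb.
  by apply: leq_trans h.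
move=> ys; rewrite mem_combs => /andP[sub /eqP sz].
case: ys sz sub => // z ys _ sub; rewrite /straddles /=.
have := subseq_sorted leq_trans sub srt' => /sorted_head_last h.
have : z \in y :: s by apply: (mem_subseq sub); rewrite mem_head.
rewrite inE => /orP[/eqP e|zs]; first by subst z; apply: leq_trans h.
have := order_path_min leq_trans srt' => /allP /(_ _ zs); lia.
Qed.

(** A selection weighs at most what it would with all its zeros at its first position, and strictly
    less than the optimum if it straddles; [count_straddles] provides two such selections. *)
Lemma sum_combs_gap a b c m s xm :
  0 < a -> 1 < b -> 0 < c -> b < size s -> sorted leq s -> straddles s ->
  (forall x, x <= m -> 'C(x, a) * 'C(m - x, c) <= 'C(xm, a) * 'C(m - xm, c)) ->
  0 < 'C(xm, a) * 'C(m - xm, c) -> all (fun x => x <= m) s ->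
  \sum_(ys <- combs b s) ends_weight a c m ys + 2 <=
  'C(size s, b) * ('C(xm, a) * 'C(m - xm, c)).
Proof.
move=> ha hb hc hs srt str hmax fpos hall.
apply: leq_trans (_ : \sum_(ys <- combs b s) ends_weight a c m ys +
                     count straddles (combs b s) <= _).
  by rewrite leq_add2l count_straddles.
rewrite -size_combs; apply: sum_loss => /= ys.
rewrite mem_combs => /andP[sub /eqP sz].
case: ys sub sz => [|x ys] sub sz; first by rewrite -sz in hb.
rewrite /ends_weight /straddles /=.
have xy := sorted_head_last (subseq_sorted leq_trans sub srt).
have hxm : x <= m.
  by apply: (allP hall); apply: (mem_subseq sub); rewrite mem_head.
have hlm : last x ys <= m.
  by apply: (allP hall); apply: (mem_subseq sub); apply: mem_last.
have hx := hmax _ hxm.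
case: ltnP => [lt|ge]; last first.
  rewrite (_ : last x ys = x) ?addn0 //.
  by apply/eqP; rewrite eqn_leq ge xy.
rewrite addn1.
have [hxa|hxa] := ltnP x a; first by rewrite (bin_small hxa).
have [hlc|hlc] := ltnP (m - last x ys) c; first by rewrite (bin_small hlc) muln0.
apply: leq_trans hx; rewrite ltn_pmul2l ?bin_gt0 //.
apply: ltn_bin; first by apply: ltn_sub2l => //; apply: leq_trans lt hlm.
by rewrite hc (leq_trans hlc) // leq_sub2l.
Qed.

Lemma size_counts w : size w = count_mem true w + count_mem false w.
Proof. by elim: w => //= -[] w ->; lia. Qed.

Lemma ord_maximiser (f : nat -> nat) m :
  exists2 xm, xm <= m & forall x, x <= m -> f x <= f xm.
Proof.
have card0 : 0 < #|'I_m.+1| by rewrite card_ord.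
have [i hi] := eq_bigmax (fun x : 'I_m.+1 => f x) card0.
exists i => [|x hx]; first by have := ltn_ord i; lia.
rewrite -hi; have hx' : x < m.+1 by [].
exact: (leq_bigmax (Ordinal hx')).
Qed.

Lemma sum_ord2 (x : 'I_2 -> nat) : \sum_i x i = x ord0 + x ord_max.
Proof. by rewrite big_ord_recr /= big_ord1; congr (x _ + _); apply: val_inj. Qed.

Lemma binprod_ord2 a b (x : 'I_2 -> nat) :
  binprod (fun i : 'I_2 => nth 0 [:: a; b] i) x = 'C(x ord0, a) * 'C(x ord_max, b).
Proof.
by rewrite /binprod big_ord_recr /= big_ord1; congr ('C(x _, _) * _); apply: val_inj.
Qed.

Lemma bin2_neq_pred_max a c m x xm : 0 < a -> 0 < c -> (1 < a) || (1 < c) ->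
  a + c + 2 <= m -> x <= m -> xm <= m ->
  (forall x, x <= m -> 'C(x, a) * 'C(m - x, c) <= 'C(xm, a) * 'C(m - xm, c)) ->
  'C(x, a) * 'C(m - x, c) + 1 <> 'C(xm, a) * 'C(m - xm, c).
Proof.
move=> ha hc hac hm hx hxm hmax.
pose P := fun i : 'I_2 => nth 0 [:: a; c] i.
pose V x := fun i : 'I_2 => nth 0 [:: x; m - x] i.
have VE z : binprod P (V z) = 'C(z, a) * 'C(m - z, c) by rewrite binprod_ord2.
rewrite -!VE; apply: (@binprod_neq_pred_max _ P (V x) (V xm) m).
- by case=> [[|[]]].
- by case/orP: hac; [exists ord0 | exists ord_max].
- by rewrite sum_ord2.
- by rewrite sum_ord2 /V /= subnKC.
- by rewrite sum_ord2 /V /= subnKC.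
move=> z; rewrite sum_ord2 => hz; rewrite VE binprod_ord2.
have <- : m - z ord0 = z ord_max by lia.
by apply: hmax; lia.
Qed.

Definition runs3 a b c := nseq a true ++ nseq b false ++ nseq c true.

Definition bin3 a b c i j k := 'C(i, a) * 'C(j, b) * 'C(k, c).

(** Each zero contributes separately, so the loss against the block word with all zeros at a best
    position is a sum of defects. A total loss of 1 needs a zero worth one less than the best, which
    [bin2_neq_pred_max] excludes for [m >= a + c + 2]; for smaller [m] a block word with one zero
    fewer wins by 2. *)
Lemma sum_single_gap a c m s :
  0 < a -> 0 < c -> (1 < a) || (1 < c) -> all (fun x => x <= m) s ->
  a + c <= m -> a + c + 3 <= m + size s -> ~~ ((a + c == 3) && (m + size s == 6)) ->
  exists i j k, i + j + k = m + size s /\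
    (\sum_(x <- s) 'C(x, a) * 'C(m - x, c) = bin3 a 1 c i j k \/
     \sum_(x <- s) 'C(x, a) * 'C(m - x, c) + 2 <= bin3 a 1 c i j k).
Proof.
move=> ha hc hac hall hm hn hexc.
pose f x := 'C(x, a) * 'C(m - x, c).
set S := \sum_(x <- s) _; have SE : S = \sum_(x <- s) f x by [].
have [xm hxm hmax] := ord_maximiser f m.
have hL : \sum_(x <- s) f x + \sum_(x <- s) (f xm - f x) = size s * f xm.
  rewrite -big_split /= big_seq (eq_bigr (fun=> f xm)).
    by rewrite -big_seq big_const_seq count_predT iter_addn_0 mulnC.
  by move=> x xs; rewrite subnKC // hmax // (allP hall).
have fpos : 0 < f xm.
  by apply: leq_trans (hmax a _); rewrite ?/f ?muln_gt0 ?bin_gt0 ?leqnn /=; lia.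
have hb : bin3 a 1 c xm (size s) (m - xm) = size s * f xm.
  by rewrite /bin3 bin1 /f; lia.
move: hL; rewrite -SE; case hl : (\sum_(x <- s) (f xm - f x)) => [|[|l]] hL.
- by exists xm, (size s), (m - xm); split; [lia | left; rewrite hb -hL addn0].
- have [x xs hx] : exists2 x, x \in s & f x + 1 = f xm.
    have /hasP[x xs fx] : has (fun x => f x < f xm) s.
      rewrite -[has _ _]negbK -all_predC; apply/negP => /allP h.
      move: hl; rewrite big_seq big1 // => x xs.
      by have := h x xs; rewrite /= -leqNgt => ?; apply/eqP; rewrite subn_eq0.
    exists x => //; move: hl; rewrite (big_rem x) //=; lia.
  have hxmm := allP hall x xs.
  have [ge|lt] := leqP (a + c + 2) m.
    by case: (bin2_neq_pred_max ha hc hac ge hxmm hxm hmax).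
  have a_xm : a <= xm by rewrite -bin_gt0; move: fpos; rewrite /f muln_gt0 => /andP[].
  have c_xm : c <= m - xm by rewrite -bin_gt0; move: fpos; rewrite /f muln_gt0 => /andP[].
  (* With [m = a + c] every zero is worth at most 1, so the word counts only [size s - 1]. *)
  have [em|em] : m = a + c \/ m = a + c + 1 by lia.
    have fE : f xm = 1.
      have e1 : xm = a by lia.
      have e2 : m - xm = c by lia.
      by rewrite /f e2 e1 !binn.
    move: hL; rewrite fE muln1 => hL.
    have [ga|la] := ltnP 1 a.
      exists a.+1, (size s).-1, c; split; first by lia.
      right; rewrite /bin3 bin1 binn binSn muln1; nia.
    exists a, (size s).-1, c.+1; split; first by lia.
    right; rewrite /bin3 bin1 binn binSn mul1n; nia.
  (* Now [m = a + c + 1]. The hypothesis [hexc] removes [a + c = 3] with two zeros, where the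
     competitor can win by 1 only. *)
  have fv z : z <= m -> f z = if z == a then c.+1 else if z == a.+1 then a.+1 else 0.
    move=> hz; rewrite /f; case: eqP => [->|n1].
      by rewrite (_ : m - a = c.+1) ?binn ?binSn ?mul1n //; lia.
    case: eqP => [->|n2].
      by rewrite (_ : m - a.+1 = c) ?binn ?binSn ?muln1 //; lia.
    have [?|?] := ltnP z a; first by rewrite bin_small.
    by rewrite [X in _ * X]bin_small ?muln0 //; lia.
  exists a.+1, (size s).-1, c.+1; split; first by lia.
  right; rewrite /bin3 bin1 !binSn.
  move: hL hx fpos; rewrite (fv xm hxm) (fv x hxmm).
  have : size s >= 2 by lia.
  have : ~~ ((a + c == 3) && (size s == 2)) by move: hexc; lia.
  move: S {SE} (size s) => S j; clear -ha hc hac.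
  have key q k : 0 < q -> ~~ ((q == 1) && (k == 0)) -> S + 1 = k.+2 * q.+2 ->
      S + 2 <= q.+1 * k.+1 * q.+2.
    move=> hq hk e; have : k.+3 * q.+2 <= q.+1 * k.+1 * q.+2 by rewrite leq_mul2r; nia.
    lia.
  case: j => [|[|k]] //; have := key a k; have := key c k.
  case: (xm == a); case: (xm == a.+1); case: (x == a); case: (x == a.+1) => //; nia.
exists xm, (size s), (m - xm); split; first by lia.
by right; rewrite hb -hL leq_add2l.
Qed.

Lemma bin_add_leq i d a : 'C(i, a.+1) + d * 'C(i, a) <= 'C(i + d, a.+1).
Proof.
elim: d => [|d IH]; first by rewrite mul0n !addn0.
rewrite addnS binS mulSn; have : 'C(i, a) <= 'C(i + d, a) by apply: leq_bin2l; lia.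
lia.
Qed.

Lemma bin_ge2 n k : 0 < k -> k < n -> 1 < 'C(n, k).
Proof. by move=> hk /bin_pred_leq[h _]; apply: leq_trans h. Qed.

Lemma combs_full T (s : seq T) : combs (size s) s = [:: s].
Proof.
elim: s => //= x s ->; rewrite (_ : combs _ _ = [::]) //.
by apply: size0nil; rewrite size_combs bin_small.
Qed.

Lemma combs_over T b (s : seq T) : size s < b -> combs b s = [::].
Proof. by move=> h; apply: size0nil; rewrite size_combs bin_small. Qed.

Lemma sorted_not_straddling s : sorted leq s -> ~~ straddles s ->
  s = nseq (size s) (head 0 s).
Proof.
case: s => // x s srt; rewrite /straddles -leqNgt /= => le.
congr (_ :: _); apply/all_pred1P/allP => y ys /=.
have xy := allP (order_path_min leq_trans srt) _ ys.
case/splitPr: ys srt le => s1 s2; rewrite last_cat /= cat_path /= => /and3P[_ _ p2].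
have := sorted_head_last p2; rewrite eqn_leq xy andbT => h1 h2.
exact: leq_trans h1 h2.
Qed.

(** Words without occurrences or with all zeros in one block are immediate. A pattern with one zero
    is [sum_single_gap], and a word with more zeros than the pattern is [sum_combs_gap]. Otherwise
    the only selection takes all zeros, and gathering them at the last or at the first position
    gains at least 2. *)
Lemma cnt_runs3_alt a b c w : 0 < a -> 0 < b -> 0 < c ->
  [|| 1 < a, 1 < b | 1 < c] -> a + b + c + 2 <= size w ->
  ~~ [&& b == 1, a + c == 3 & size w == 6] ->
  exists i j k, i + j + k = size w /\
    (cnt (runs3 a b c) w = bin3 a b c i j k \/
     cnt (runs3 a b c) w + 2 <= bin3 a b c i j k).
Proof.
case: b => // b ha _ hc habc hn hexc; rewrite /runs3 cnt_runs.
have := size_zpos 0 w; have := zpos_sorted 0 w; have := zpos_bounds 0 w.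
move: (size_counts w) => hsz; set m := count_mem true w in hsz *.
set s := zpos 0 w => hall srt hs.
have {}hall : all (fun x => x <= m) s by apply: sub_all hall => x; lia.
have nm : size w = m + size s by rewrite hsz hs.
rewrite nm in hn hexc *.
set S := \sum_(ys <- _) _.
have [S0|Spos] := posnP S.
  pose P (i : 'I_3) := nth 0 [:: a; b.+1; c] i.
  have hP : \sum_i P i + 2 <= m + size s by rewrite !big_ord_recl big_ord0 /P /=; lia.
  have ha0 : 0 < P ord0 by [].
  have [z [zn hz]] := leq_binprod_gt2 ha0 hP.
  move: zn hz; rewrite /binprod !big_ord_recl !big_ord0 /= muln1 addn0 => zn hz.
  eexists _, _, _; split; first by rewrite -addnA; exact: zn.
  by right; rewrite S0 /bin3 -mulnA; exact: ltnW hz.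
have [str|/(sorted_not_straddling srt) sE] := boolP (straddles s); last first.
  exists (head 0 s), (size s), (m - head 0 s); split.
    suff : head 0 s <= m by lia.
    by move: hall; case: (s) => //= x s' /andP[].
  by left; rewrite /S {1}sE sum_combs_constant.
have [bs|/combs_over cE] := leqP b.+1 (size s); last by move: Spos; rewrite /S cE big_nil.
have hlm ys : ys \in combs b.+1 s -> head 0 ys <= last 0 ys <= m.
  rewrite mem_combs; case: ys => // x ys /andP[sub _] /=.
  rewrite (sorted_head_last (subseq_sorted leq_trans sub srt)).
  by apply: (allP hall); apply: (mem_subseq sub); apply: mem_last.
have acm : a + c <= m.
  rewrite leqNgt; apply/negP => lt; move: Spos.
  rewrite /S big_seq big1 // => ys /hlm /andP[h1 h2]; rewrite /ends_weight.
  have [l|ge] := ltnP (head 0 ys) a; first by rewrite bin_small.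
  by rewrite ['C(m - _, c)]bin_small ?muln0 //; lia.
have [xm hxm hmax] := ord_maximiser (fun x => 'C(x, a) * 'C(m - x, c)) m.
have fpos : 0 < 'C(xm, a) * 'C(m - xm, c).
  by apply: leq_trans (hmax a _); rewrite ?muln_gt0 ?bin_gt0 ?leqnn /=; lia.
have [b0|b1] := posnP b.
  subst b; rewrite /S combs1 big_map.
  apply: sum_single_gap => //; lia.
have [lt|ge] := ltnP b.+1 (size s).
  exists xm, (size s), (m - xm); split; first by lia.
  right; rewrite /bin3 ['C(xm, a) * _]mulnC -mulnA.
  exact: sum_combs_gap.
have sb : size s = b.+1 by lia.
have {hlm}/andP[h1 h2] : head 0 s <= last 0 s <= m.
  by apply: hlm; rewrite -sb combs_full mem_head.
move: Spos str; rewrite {}/S -sb combs_full big_seq1 /ends_weight /straddles sb.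
move: (head 0 s) (last 0 s) h1 h2 => i l h1 h2; rewrite muln_gt0 !bin_gt0 => /andP[hi hk] il.
have [d hd] : exists d, l = i + d.+1 by exists (l - i).-1; lia.
have [k hkE] : exists k, m = l + k by exists (m - l); lia.
move: hi hk; rewrite hkE addKn => hi hk.
case: a c ha hc habc hn hexc acm hmax fpos hi hk => [|a] [|c] // _ _ habc hn _ _ _ _ hi hk.
have eL := bin_add_leq i d.+1 a; have eR := bin_add_leq k d.+1 c.
have pi : 0 < 'C(i, a.+1) by rewrite bin_gt0.
have pk : 0 < 'C(k, c.+1) by rewrite bin_gt0.
(* If neither way of gathering the zeros gains 2, then [d = 0], [i = a.+1] and [k = c.+1]: the word
   is only one letter longer than the pattern, against [hn]. *)
have [gL|gL] := ltnP 1 (d.+1 * 'C(i, a) * 'C(k, c.+1)).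
  exists (i + d.+1), b.+1, k; split; first by lia.
  right; rewrite /bin3 binn muln1; have := leq_mul eL (leqnn 'C(k, c.+1)); lia.
have [gR|gR] := ltnP 1 ('C(i, a.+1) * (d.+1 * 'C(k, c))).
  exists i, b.+1, (k + d.+1); split; first by lia.
  right; rewrite /bin3 binn muln1; have := leq_mul (leqnn 'C(i, a.+1)) eR; lia.
have pi' : 0 < 'C(i, a) by rewrite bin_gt0 ltnW.
have pk' : 0 < 'C(k, c) by rewrite bin_gt0 ltnW.
have k1 : 'C(k, c.+1) = 1.
  by apply/eqP; rewrite eqn_leq pk andbT; apply: leq_trans gL; rewrite leq_pmull // muln_gt0.
have i1 : 'C(i, a.+1) = 1.
  by apply/eqP; rewrite eqn_leq pi andbT; apply: leq_trans gR; rewrite leq_pmulr // muln_gt0.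
have := bin_eq1 (ltn0Sn _) k1; have := bin_eq1 (ltn0Sn _) i1 => ia kc.
have d0 : d = 0 by move: gL; rewrite k1 muln1; case: (d) => // d'; nia.
move: gL gR; rewrite d0 k1 i1 ia kc !binSn; lia.
Qed.

Lemma sum_combs_le b s (g : seq nat -> nat) f :
  (forall ys, subseq ys s -> g ys <= f) -> \sum_(ys <- combs b s) g ys <= 'C(size s, b) * f.
Proof.
move=> h; rewrite -size_combs -sum1_size big_distrl /= big_seq [leqRHS]big_seq.
by apply: leq_sum => ys; rewrite mem_combs mul1n => /andP[/h].
Qed.

(** Without a final run the weight depends on the first chosen zero alone, so straddling by itself
    costs nothing. The comparison is with all ones placed before all zeros, and the loss comes from
    selections through the first zero of [w]. *)
Lemma cnt_runs2_alt a b w : 0 < a -> 0 < b -> (1 < a) || (1 < b) ->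
  a + b + 2 <= size w ->
  exists i j, i + j = size w /\
    (cnt (runs3 a b 0) w = 'C(i, a) * 'C(j, b) \/
     cnt (runs3 a b 0) w + 2 <= 'C(i, a) * 'C(j, b)).
Proof.
case: a b => [|a] [|b] // _ _ hab hn; rewrite /runs3 cnt_runs.
have := size_zpos 0 w; have := zpos_sorted 0 w; have := zpos_bounds 0 w.
move: (size_counts w) => hsz; set m := count_mem true w in hsz *.
set s := zpos 0 w => hall srt hs.
have {}hall : all (fun x => x <= m) s by apply: sub_all hall => x; lia.
have nm : size w = m + size s by rewrite hsz hs.
rewrite nm in hn *.
set S := \sum_(ys <- _) _.
have SE : S = \sum_(ys <- combs b.+1 s) 'C(head 0 ys, a.+1).
  by apply: eq_bigr => ys _; rewrite /ends_weight bin0 muln1.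
have [S0|Spos] := posnP S.
  exists (a + 3), (m + size s - (a + 3)); split; first by lia.
  right; rewrite S0 (_ : a + 3 = a.+3) ?bin_add2; last by lia.
  rewrite add0n -[2]muln1; apply: leq_mul; last by rewrite bin_gt0; lia.
  by rewrite -bin_add2; apply: bin_ge2.
have [bs|/combs_over cE] := leqP b.+1 (size s); last by move: Spos; rewrite /S cE big_nil.
have am : a < m.
  rewrite ltnNge; apply/negP => le; move: Spos; rewrite SE big_seq big1 // => ys.
  rewrite mem_combs => /andP[sub _]; rewrite bin_small //.
  case: ys sub => // y ys /mem_subseq /(_ y (mem_head _ _)) /(allP hall) /=; lia.
have hm0 : head 0 s <= m by move: hall; case: (s) => //= x s' /andP[].
have [xm|mx] := ltnP (head 0 s) m; last first.
  have hd : head 0 s = m by apply/eqP; rewrite eqn_leq hm0.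
  have str : ~~ straddles s.
    rewrite /straddles hd -leqNgt; case: (s) hall => // x s' /allP h.
    exact: (h _ (mem_last x s')).
  exists m, (size s); split=> //; left.
  by rewrite /S {1}(sorted_not_straddling srt str) hd sum_combs_constant bin0 muln1.
clearbody S; clearbody s.
case: m am hall hn nm SE hm0 xm {hsz} => // m am hall hn nm SE _.
case: s {hs nm} srt hall hn bs SE => // x s srt /andP[_ hall] hn bs SE xm.
rewrite /= in hn bs xm.
(* At most [m] of the [m.+1] ones precede the first zero, so each of the [C(size s, b)] selections
   through it loses at least [C(m,a)]. *)
have hS : S + 'C(size s, b) * 'C(m, a) <= 'C(m.+1, a.+1) * 'C((size s).+1, b.+1).
  rewrite SE combsS big_cat big_map /= big_const_seq count_predT iter_addn_0 size_combs.
  have hx : 'C(x, a.+1) <= 'C(m, a.+1) by apply: leq_bin2l.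
  have hr : \sum_(ys <- combs b.+1 s) 'C(head 0 ys, a.+1) <= 'C(size s, b.+1) * 'C(m.+1, a.+1).
    apply: sum_combs_le => ys sub; apply: leq_bin2l.
    case: ys sub => // y ys /mem_subseq /(_ y (mem_head _ _)) /(allP hall) //.
  rewrite mulnC [_ * 'C(_.+1, b.+1)]mulnC binS mulnDl.
  have := leq_mul (leqnn 'C(size s, b)) hx; rewrite ['C(m.+1, _)]binS in hr *; lia.
have hs0 : 0 < 'C(size s, b) by rewrite bin_gt0.
have hm0 : 0 < 'C(m, a) by rewrite bin_gt0.
have [g2|g1] := ltnP 1 ('C(size s, b) * 'C(m, a)).
  exists m.+1, (size s).+1; split=> //; right; lia.
have bin1P n k : k <= n -> 'C(n, k) <= 1 -> k = 0 \/ n = k.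
  move=> kn h; case: (posnP k) => [|k0]; [by left|right].
  case: (ltnP k n) => [/(bin_ge2 k0)|]; lia.
(* A loss of at most 1 makes both binomials equal to 1. In the two cases left by [hab] and [hn], a
   block word with one more or one fewer one wins. *)
have hb : b = 0 \/ size s = b by apply: bin1P => //; move: g1; case: 'C(m, a) hm0 => //; nia.
have ha : a = 0 \/ m = a by apply: bin1P => //; move: g1; case: 'C(size s, b) hs0 => //; nia.
move: hS; case: hb => hb; case: ha => ha; try lia.
- subst b m; rewrite !binn bin0 => hS.
  exists a.+2, (size s); split => /=; first by lia.
  move: hS; rewrite binSn !bin1; right; nia.
- subst a b; rewrite binn bin1 bin0 binn => hS.
  exists m, (size s).+2; split => /=; first by lia.
  move: hS; rewrite binSn ?bin1; right; nia.
Qed.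

(** * Attained values and the complement symmetry *)

Lemma B_neq0P n p k : B n p k != 0 <-> exists2 w, size w = n & cnt p w = k.
Proof.
rewrite /B cards_eq0; split.
  case/set0Pn => w; rewrite inE occE => /eqP e; exists w => //; exact: size_tuple.
case=> w /eqP hw e; apply/set0Pn; exists (Tuple hw).
by rewrite inE occE /= e.
Qed.

Lemma cnt_leq_M p w : cnt p w <= M (size w) p.
Proof. by rewrite -occE; apply: (leq_bigmax (in_tuple w)). Qed.

Lemma M_attained n p : exists2 w, size w = n & cnt p w = M n p.
Proof.
have h : 0 < #|{: n.-tuple bool}| by rewrite card_tuple expn_gt0 card_bool.
have [w hw] := eq_bigmax (fun w : n.-tuple bool => occ p w) h.
by exists w; rewrite ?size_tuple // -occE -hw.
Qed.

Lemma map_tuple_negb_inj n : injective (@map_tuple n _ _ negb).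
Proof. by move=> u v /(congr1 val) /= /(inj_map negb_inj) /val_inj. Qed.

Lemma occ_map_negb p w : occ (map negb p) (map negb w) = occ p w.
Proof. by rewrite !occE cnt_map_negb. Qed.

Lemma B_map_negb n p k : B n (map negb p) k = B n p k.
Proof.
rewrite /B -(card_preimset _ (@map_tuple_negb_inj n)).
by congr #|pred_of_set _|; apply/setP => w; rewrite !inE occ_map_negb.
Qed.

Lemma M_map_negb n p : M n (map negb p) = M n p.
Proof.
rewrite /M (reindex_inj (@map_tuple_negb_inj n)).
by apply: eq_bigr => w _; rewrite occ_map_negb.
Qed.

Lemma internal_zero_map_negb p n : internal_zero (map negb p) n <-> internal_zero p n.
Proof.
by split=> -[k1 [k2 [k3 h]]]; exists k1, k2, k3; move: h; rewrite !B_map_negb.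
Qed.

Lemma alternating_map_negb p : alternating (map negb p) = alternating p.
Proof.
rewrite /alternating sorted_map; apply: eq_sorted => a b /=.
by rewrite (inj_eq negb_inj).
Qed.

Lemma triv_equiv_map_negb p q : triv_equiv (map negb p) q = triv_equiv p q.
Proof.
by rewrite /triv_equiv (mapK negbK) !inE orbA orbC -orbA.
Qed.

Lemma cnt_self p : 0 < cnt p p.
Proof. by elim: p => //= x p IH; rewrite eqxx mul1n addn_gt0 IH orbT. Qed.

(** Doubling the first letter of the pattern already gives two occurrences; the other letters are
    padding. *)
Lemma M_ge2 x p n : size p + 2 <= n -> 1 < M n (x :: p).
Proof.
move=> hn; pose u := x :: x :: p.
have h : cnt (x :: p) u <= cnt (x :: p) (nseq (n - size u) x ++ u).
  by elim: (n - size u) => //= k; lia.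
have := cnt_leq_M (x :: p) (nseq (n - size u) x ++ u).
rewrite size_cat size_nseq subnK; last by rewrite /u /=; lia.
apply: leq_trans; apply: leq_trans h; rewrite /= eqxx !mul1n.
by have := cnt_self p; lia.
Qed.

(** Since the maximum is at least 2, the missed value lies above 0, which is attained by a constant
    word avoiding [x]. *)
Lemma internal_zeroI x p n : size p + 2 <= n ->
  B n (x :: p) (M n (x :: p) - 1) = 0 -> internal_zero (x :: p) n.
Proof.
move=> hn h0; have hM := M_ge2 x hn.
exists 0, (M n (x :: p) - 1), (M n (x :: p)); split => //; try lia.
  apply/B_neq0P; exists (nseq n (~~ x)); first exact: size_nseq.
  by apply: cnt_skip; rewrite mem_nseq; case: x {h0 hM}; rewrite andbF.
by apply/B_neq0P; exact: M_attained.
Qed.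

(** * The value one below the maximum *)

(** Being beaten by 2 is impossible at [M] and at [M - 1], so both values would come from block
    words, against [binprod_neq_pred_max]. *)
Lemma cnt_runs3_neq_pred_max a b c w : 0 < a -> 0 < b -> 0 < c ->
  [|| 1 < a, 1 < b | 1 < c] -> a + b + c + 2 <= size w ->
  ~~ [&& b == 1, a + c == 3 & size w == 6] ->
  cnt (runs3 a b c) w + 1 <> M (size w) (runs3 a b c).
Proof.
move=> ha hb hc habc hn hexc; set n := size w => hM.
have ub i j k : i + j + k = n -> bin3 a b c i j k <= M n (runs3 a b c).
  move=> e; pose u := nseq i true ++ nseq j false ++ nseq k true.
  have <- : size u = n by rewrite !size_cat !size_nseq addnA.
  rewrite /bin3; case: b {hexc habc hn hM} hb => // b _.
  by rewrite -cnt_block; exact: cnt_leq_M.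
have [i [j [k [e he]]]] := cnt_runs3_alt ha hb hc habc hn hexc.
have := ub _ _ _ e; case: he => [he _|]; last by lia.
have [v hv hvM] := M_attained n (runs3 a b c).
rewrite -/n -hv in hn hexc.
have [i' [j' [k' [e' he']]]] := cnt_runs3_alt ha hb hc habc hn hexc.
rewrite hv in e'; have := ub _ _ _ e'; case: he' => [he' _|]; last by lia.
pose P (s : 'I_3) := nth 0 [:: a; b; c] s.
pose V i j k (s : 'I_3) := nth 0 [:: i; j; k] s.
have sumV x y z : \sum_s V x y z s = x + y + z.
  by rewrite !big_ord_recl big_ord0 /V /=; lia.
have PV x y z : binprod P (V x y z) = bin3 a b c x y z.
  by rewrite /binprod /bin3 !big_ord_recl big_ord0 /V /P /= muln1 mulnA.
apply: (@binprod_neq_pred_max _ P (V i j k) (V i' j' k') n).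
- by case=> [[|[|[]]]].
- case/or3P: habc => h; [by exists ord0 | by exists (lift ord0 ord0) |].
  by exists (lift ord0 (lift ord0 ord0)).
- by rewrite (sumV a b c) -hv.
- by rewrite sumV.
- by rewrite sumV.
- move=> z; rewrite PV -he' hvM !big_ord_recl big_ord0 addn0 addnA => /ub.
  by rewrite /binprod /bin3 !big_ord_recl big_ord0 /P /= muln1 mulnA.
by rewrite !PV -he -he' hvM.
Qed.

Lemma cnt_runs2_neq_pred_max a b w : 0 < a -> 0 < b -> (1 < a) || (1 < b) ->
  a + b + 2 <= size w ->
  cnt (runs3 a b 0) w + 1 <> M (size w) (runs3 a b 0).
Proof.
move=> ha hb hab hn; set n := size w => hM.
have ub i j : i + j = n -> 'C(i, a) * 'C(j, b) <= M n (runs3 a b 0).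
  move=> e; pose u := nseq i true ++ nseq j false ++ nseq 0 true.
  have <- : size u = n by rewrite !size_cat !size_nseq addn0.
  case: b {hab hn hM} hb => // b _.
  by rewrite -[_ * _]muln1 -(bin0 0) -cnt_block; exact: cnt_leq_M.
have [i [j [e he]]] := cnt_runs2_alt ha hb hab hn.
have := ub _ _ e; case: he => [he _|]; last by lia.
have [v hv hvM] := M_attained n (runs3 a b 0).
rewrite -/n -hv in hn.
have [i' [j' [e' he']]] := cnt_runs2_alt ha hb hab hn.
rewrite hv in e' hn; have := ub _ _ e'; case: he' => [he' _|]; last by lia.
have ej : j = n - i by lia.
have ej' : j' = n - i' by lia.
apply: (@bin2_neq_pred_max a b n i i') => //; try lia.
  by move=> x hx; rewrite -ej' -he' hvM; apply: ub; lia.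
by rewrite -ej -ej' -he -he' hvM.
Qed.

(** The values are [C(i,a)] for [i] ones, and the two largest differ by [C(n-1,a-1) >= 2], where [n]
    is the length. *)
Lemma cnt_run1_neq_pred_max a w : 1 < a -> a + 2 <= size w ->
  cnt (nseq a true) w + 1 <> M (size w) (nseq a true).
Proof.
case: a => // a ha hn; rewrite cnt_nseq => hM.
have := cnt_leq_M (nseq a.+1 true) (nseq (size w) true).
have [v hv] := M_attained (size w) (nseq a.+1 true).
rewrite !cnt_nseq !size_nseq count_nseq mul1n -hM => hvM.
have h u : 'C(count_mem true u, a.+1) <= 'C(size u, a.+1).
  by apply: leq_bin2l; exact: count_size.
have := h v; rewrite hv hvM.
case: (ltnP (count_mem true w) (size w)) => hw; last first.
  have -> : count_mem true w = size w by apply/eqP; rewrite eqn_leq hw count_size.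
  lia.
have : 'C(count_mem true w, a.+1) <= 'C((size w).-1, a.+1) by apply: leq_bin2l; lia.
have : 1 < 'C((size w).-1, a) by apply: bin_ge2; lia.
have -> : 'C(size w, a.+1) = 'C((size w).-1, a.+1) + 'C((size w).-1, a).
  by case: (size w) hn => // k _; rewrite binS.
lia.
Qed.

Lemma nruns_peel x p : exists a q, [/\ x :: p = nseq a.+1 x ++ q,
  nruns (x :: p) = (nruns q).+1 & q = [::] \/ exists q', q = ~~ x :: q'].
Proof.
elim: p => [|y p [a [q [e1 e2 e3]]]]; first by exists 0, [::]; split => //; left.
case: (x =P y) => [<-|/eqP ne].
  exists a.+1, q; split => //; first by rewrite e1.
  by rewrite -e2 /= eqxx.
exists 0, (y :: p); split => //; first by rewrite /= (negbTE ne) -/nruns /=; case: (p).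
by right; exists p; congr (_ :: _); case: (x) (y) ne => [] [].
Qed.

(** * Alternating patterns: all smaller values are attained *)

Definition downward_attained p n :=
  forall w, size w = n -> forall k, k <= cnt p w -> exists2 v, size v = n & cnt p v = k.

Lemma downward_no_internal_zero p n : downward_attained p n -> ~ internal_zero p n.
Proof.
move=> h [k1 [k2 [k3 [_ lt _ k20 /B_neq0P[w hw e]]]]].
suff /B_neq0P : exists2 v, size v = n & cnt p v = k2 by rewrite k20.
by apply: (h w) => //; rewrite e ltnW.
Qed.

Lemma downward_single n : downward_attained (runs3 1 0 0) n.
Proof.
move=> w hw k; rewrite (cnt_nseq 1) bin1 => hk.
have kn : k <= n by rewrite -hw (leq_trans hk) // count_size.
exists (nseq k true ++ nseq (n - k) false).
  by rewrite size_cat !size_nseq subnKC.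
by rewrite (cnt_nseq 1) bin1 count_cat !count_nseq mul1n mul0n addn0.
Qed.

Lemma split_at_count w x : x <= count_mem true w ->
  exists u v, w = u ++ v /\ count_mem true u = x.
Proof.
case: x => [|x]; first by exists [::], w.
elim: w x => // -[] w IH x /= hx.
  case: x hx => [|x] hx; first by exists [:: true], w.
  by have [u [v [-> e]]] := IH x hx; exists (true :: u), v; rewrite /= e.
by have [u [v [-> e]]] := IH x hx; exists (false :: u), v; rewrite /= e.
Qed.

(** Zeros are inserted one by one at the prescribed heights. The order is lost, but the counts used
    here are symmetric sums over the zeros. *)
Lemma zpos_realise m s : all (fun x => x <= m) s ->
  exists w, [/\ count_mem true w = m, size w = m + size s & perm_eq (zpos 0 w) s].
Proof.
elim: s => [_|x s IH /= /andP[xm /IH[w [hm sz hs]]]].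
  exists (nseq m true); rewrite count_nseq mul1n size_nseq addn0 zpos_nseq.
  by split.
have [u [v [E e]]] : exists u v, w = u ++ v /\ count_mem true u = x.
  by apply: split_at_count; rewrite hm.
exists (u ++ false :: v); split.
- by rewrite -hm E !count_cat.
- by rewrite addnS -sz E !size_cat addnS.
rewrite E zpos_cat add0n e -(perm_cons x) in hs; apply: perm_trans hs.
by rewrite zpos_cat /= add0n e; apply/permPl; exact: (perm_catCA _ [:: x] _).
Qed.

Lemma cnt_10E w : cnt (runs3 1 1 0) w = \sum_(x <- zpos 0 w) x.
Proof.
rewrite /runs3 cnt_runs combs1 big_map; apply: eq_bigr => x _.
by rewrite /ends_weight bin0 bin1 muln1.
Qed.

Lemma cnt_101E w :
  cnt (runs3 1 1 1) w = \sum_(x <- zpos 0 w) x * (count_mem true w - x).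
Proof.
rewrite /runs3 cnt_runs combs1 big_map; apply: eq_bigr => x _.
by rewrite /ends_weight !bin1.
Qed.

Lemma bounded_sum m j k : k <= m * j ->
  exists s, [/\ size s = j, all (fun x => x <= m) s & \sum_(x <- s) x = k].
Proof.
elim: j k => [|j IH] k hk; first by exists [::]; rewrite big_nil; split=> //; lia.
have [|s [e1 e2 e3]] := IH (k - minn k m); first by lia.
exists (minn k m :: s); rewrite big_cons e3 /= e1 e2 geq_minr; split => //; lia.
Qed.

Lemma sum_leq_const (s : seq nat) (f : nat -> nat) c :
  {in s, forall x, f x <= c} -> \sum_(x <- s) f x <= size s * c.
Proof.
move=> h; rewrite -sum1_size big_distrl /= big_seq [leqRHS]big_seq.
by apply: leq_sum => x xs; rewrite mul1n h.
Qed.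

Lemma zpos_all_leq w : all (fun x => x <= count_mem true w) (zpos 0 w).
Proof. by apply: sub_all (zpos_bounds 0 w) => x; lia. Qed.

(** With [m] ones and [j] zeros kept, moving the zeros reaches every value up to [m j]. *)
Lemma downward_10 n : downward_attained (runs3 1 1 0) n.
Proof.
move=> w hw k; rewrite cnt_10E => hk.
have [|s [e1 e2 e3]] := @bounded_sum (count_mem true w) (size (zpos 0 w)) k.
  by apply: leq_trans hk _; rewrite mulnC; apply: sum_leq_const; exact/allP/zpos_all_leq.
have [v [_ sz hv]] := zpos_realise e2.
exists v; last by rewrite cnt_10E (perm_big _ hv).
by rewrite sz e1 size_zpos -size_counts.
Qed.

(** * The maximum for the pattern [101] *)

Definition balanced_prod n := (n %/ 3) * (n.+1 %/ 3) * (n.+2 %/ 3).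

(** [balanced_prod] takes three parts as equal as possible. Adding 1 to each factor adds
    [xy + yz + zx + n + 1], and [3 (xy + yz + zx) <= n^2]. *)
Lemma balanced_prod_add3 n x y z : x + y + z = n ->
  x * y * z <= balanced_prod n -> x.+1 * y.+1 * z.+1 <= balanced_prod n.+3.
Proof.
rewrite /balanced_prod => e.
have E2 : 3 * (x * y + y * z + z * x) <= n * n.
  have [h1 _] := nat_Cauchy x y; have [h2 _] := nat_Cauchy y z; have [h3 _] := nat_Cauchy z x.
  by move: h1 h2 h3; rewrite -e -!mulnn; lia.
have -> : n.+3 %/ 3 = (n %/ 3).+1 by lia.
have -> : n.+4 %/ 3 = (n.+1 %/ 3).+1 by lia.
have -> : n.+4.+1 %/ 3 = (n.+2 %/ 3).+1 by lia.
have [t [r [nE hr]]] : exists t r, n = 3 * t + r /\ r < 3 by exists (n %/ 3), (n %% 3); lia.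
have -> : n %/ 3 = t by lia.
case: r nE hr => [|[|[|]]] // nE _.
- have -> : n.+1 %/ 3 = t by lia.
  have -> : n.+2 %/ 3 = t by lia.
  rewrite nE in E2; nia.
- have -> : n.+1 %/ 3 = t by lia.
  have -> : n.+2 %/ 3 = t.+1 by lia.
  rewrite nE in E2; nia.
have -> : n.+1 %/ 3 = t.+1 by lia.
have -> : n.+2 %/ 3 = t.+1 by lia.
rewrite nE in E2; nia.
Qed.

Lemma prod3_leq_balanced x y z : x * y * z <= balanced_prod (x + y + z).
Proof.
have [n hn] : exists n, x + y + z = n by eexists.
elim/ltn_ind: n x y z hn => n IH [|x] [|y] [|z] hn; rewrite ?muln0 ?mul0n //.
have -> : x.+1 + y.+1 + z.+1 = (x + y + z).+3 by lia.
apply: balanced_prod_add3 => //; apply: (IH (x + y + z)) => //; lia.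
Qed.

Lemma cnt_101_leq w : cnt (runs3 1 1 1) w <= balanced_prod (size w).
Proof.
rewrite cnt_101E; set m := count_mem true w.
have [xm hxm hmax] := ord_maximiser (fun x => x * (m - x)) m.
apply: leq_trans (_ : size (zpos 0 w) * (xm * (m - xm)) <= _).
  by apply: sum_leq_const => x /(allP (zpos_all_leq w)); exact: hmax.
have -> : size w = size (zpos 0 w) + xm + (m - xm).
  by rewrite size_zpos size_counts -/m; lia.
by rewrite mulnA prod3_leq_balanced.
Qed.

(** * Values of [101] through sums of squares *)

Definition sum_of_squares k D :=
  exists2 s : seq nat, size s = k & \sum_(d <- s) d * d = D.

Lemma sum_of_squares_widen k k' D : k <= k' -> sum_of_squares k D -> sum_of_squares k' D.
Proof.
move=> hk [s e1 e2]; exists (nseq (k' - k) 0 ++ s).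
  by rewrite size_cat size_nseq e1 subnK.
by rewrite big_cat /= e2 big_nseq iter_addn_0.
Qed.

(** A finite case of the four-square theorem; [25 = 5^2] is the bound at which the induction of
    [few_squares] starts. *)
Lemma four_squares_small D : D < 25 -> sum_of_squares 4 D.
Proof.
move=> hD; pose r := iota 0 5.
have h : all (fun D => has (fun a => has (fun b => has (fun c => has (fun d =>
   a * a + (b * b + (c * c + d * d)) == D) r) r) r) r) (iota 0 25) by vm_compute.
have Din : D \in iota 0 25 by rewrite mem_iota.
have /hasP[a _ /hasP[b _ /hasP[c _ /hasP[d _ /eqP e]]]] := allP h D Din.
by exists [:: a; b; c; d]; rewrite // !big_cons big_nil addn0.
Qed.

(** For [q > 4] and [q^2 <= D < (q+1)^2], the remainder [D - q^2 <= 2q] is below [q^2], so each step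
    costs one more square. *)
Lemma few_squares q D : D < q * q -> sum_of_squares (maxn 4 q.-1) D.
Proof.
elim: q D => // q IH D hD.
have [le|gt] := leqP q 4.
  by apply: (@sum_of_squares_widen 4); [lia | apply: four_squares_small; nia].
have [lt|ge] := ltnP D (q * q).
  by apply: sum_of_squares_widen (IH _ lt); lia.
have [|s e1 e2] := IH (D - q * q); first by nia.
by exists (q :: s); rewrite /= ?e1 ?big_cons ?e2; lia.
Qed.

(* With [2q] ones, a zero having [q - d] ones to its left contributes [q^2 - d^2]. *)
Lemma cnt_101_near_max q j D : maxn 4 q.-1 <= j -> D < q * q ->
  exists2 w, size w = 2 * q + j & cnt (runs3 1 1 1) w = j * (q * q) - D.
Proof.
move=> hj hD; have [s e1 e2] := sum_of_squares_widen hj (few_squares hD).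
have hs : {in s, forall d, d <= q}.
  move=> d ds; rewrite leqNgt; apply/negP => lt.
  have : d * d <= D by rewrite -e2 (big_rem d) //= leq_addr.
  have : q * q < d * d by rewrite ltn_mul.
  lia.
have [|w [hm sz hw]] := @zpos_realise (2 * q) [seq q - d | d <- s].
  by apply/allP => x /mapP[d ds ->]; lia.
exists w; first by rewrite sz size_map e1.
rewrite cnt_101E (perm_big _ hw) hm big_map /=.
suff : \sum_(d <- s) (q - d) * (2 * q - (q - d)) + \sum_(d <- s) d * d = j * (q * q).
  by rewrite e2; lia.
rewrite -big_split /= -e1 -sum1_size big_distrl /= big_seq [RHS]big_seq.
by apply: eq_bigr => d /hs h; nia.
Qed.

(** Removing duplicates at every level keeps the list small enough for evaluation. *)
Fixpoint sums (f : nat -> nat) (r : seq nat) j : seq nat :=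
  if j is j'.+1 then undup [seq f x + y | x <- r, y <- sums f r j'] else [:: 0].

Lemma sumsP f r j k : k \in sums f r j ->
  exists s, [/\ size s = j, {subset s <= r} & \sum_(x <- s) f x = k].
Proof.
elim: j k => [|j IH] k /=; first by rewrite inE => /eqP ->; exists [::]; rewrite big_nil.
rewrite mem_undup => /allpairsP[[x y] /= [xr /IH[s [e1 e2 e3]] ->]].
exists (x :: s); rewrite big_cons e3 /= e1; split=> // z.
by rewrite inE => /predU1P[->|/e2].
Qed.

Lemma cnt_101_small n : 7 <= n <= 11 -> forall k, k <= balanced_prod n ->
  exists2 w, size w = n & cnt (runs3 1 1 1) w = k.
Proof.
move=> hn k hk.
pose f m x := x * (m - x).
(* Even numbers of ones suffice at these lengths, as the evaluation below confirms. *)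
pose vals n := [seq v | m <- [seq m <- [:: 2; 4; 6; 8] | m <= n],
                        v <- sums (f m) (iota 0 m.+1) (n - m)].
pose covers r b := all (fun k => k \in (r : seq nat)) (iota 0 b).
have /allP /(_ n) : all (fun n => covers (vals n) (balanced_prod n).+1) (iota 7 5).
  by vm_compute.
rewrite mem_iota => /(_ hn) /allP /(_ k).
rewrite mem_iota => /(_ hk) /allpairsPdep[m [v [hm hv ->]]].
move: hm hv; rewrite mem_filter => /andP[hm _] /sumsP[s [e1 e2 e3]].
have [|w [cm sz hw]] := @zpos_realise m s.
  by apply/allP => x /e2; rewrite mem_iota.
by exists w; [rewrite sz e1; lia | rewrite cnt_101E cm (perm_big _ hw)].
Qed.

(** A zero in front creates no occurrence, so the values of the previous length persist; those above
    its maximum are supplied by [cnt_101_near_max]. *)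
Lemma cnt_101_onto n : 7 <= n -> forall k, k <= balanced_prod n ->
  exists2 w, size w = n & cnt (runs3 1 1 1) w = k.
Proof.
elim: n => // n IH hn k hk.
have [le|gt] := leqP n 10; first by apply: cnt_101_small => //; lia.
have [le|lt] := leqP k (balanced_prod n).
  have [|w hw e] := IH _ k le; first by lia.
  by exists (false :: w); rewrite /= ?hw // e addn0.
(* Here [n.+1 >= 12], so [t >= 4] and there are enough zeros for four squares. *)
have [t [r [nE hr]]] : exists t r, n.+1 = 3 * t + r /\ r < 3.
  by exists (n.+1 %/ 3), (n.+1 %% 3); lia.
move: hk lt; rewrite /balanced_prod.
case: r nE hr => [|[|[|]]] // nE _.
- have -> : n.+1 %/ 3 = t by lia.
  have -> : n.+2 %/ 3 = t by lia.
  have -> : n.+3 %/ 3 = t by lia.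
  have -> : n %/ 3 = t.-1 by lia.
  move=> hk lt; have [||w sz e] := @cnt_101_near_max t t (t * (t * t) - k); try nia.
  by exists w; nia.
- have -> : n.+1 %/ 3 = t by lia.
  have -> : n.+2 %/ 3 = t by lia.
  have -> : n.+3 %/ 3 = t.+1 by lia.
  have -> : n %/ 3 = t by lia.
  move=> hk lt; have [||w sz e] := @cnt_101_near_max t t.+1 (t.+1 * (t * t) - k); try nia.
  by exists w; nia.
have -> : n.+1 %/ 3 = t by lia.
have -> : n.+2 %/ 3 = t.+1 by lia.
have -> : n.+3 %/ 3 = t.+1 by lia.
have -> : n %/ 3 = t by lia.
move=> hk lt; have [||w sz e] := @cnt_101_near_max t.+1 t (t * (t.+1 * t.+1) - k); try nia.
by exists w; nia.
Qed.

Lemma downward_101 n : 7 <= n -> downward_attained (runs3 1 1 1) n.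
Proof.
move=> hn w hw k hk; apply: cnt_101_onto => //.
by apply: leq_trans hk _; rewrite -hw cnt_101_leq.
Qed.

(** * Reduction to run lengths, and the exceptional words *)

Lemma no_internal_zero_nil n : ~ internal_zero [::] n.
Proof.
move=> [k1 [k2 [k3 [h12 h23 /B_neq0P[w1 _ e1] _ /B_neq0P[w3 _ e3]]]]].
by move: e1 e3; rewrite !cnt_nil; lia.
Qed.

(** The condition [0 < b \/ c = 0] keeps two runs of [x] from merging, so the triple holds the true
    run lengths. *)
Lemma nruns_leq3P x p : nruns (x :: p) <= 3 ->
  exists a b c, [/\ 0 < a, 0 < b \/ c = 0 &
    x :: p = nseq a x ++ nseq b (~~ x) ++ nseq c x].
Proof.
have [a [q [-> -> hq]]] := nruns_peel x p; rewrite ltnS.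
case: hq => [-> _|[q' ->]]; first by exists a.+1, 0, 0; split => //; right.
have [b [r [-> -> hr]]] := nruns_peel (~~ x) q'; rewrite ltnS.
case: hr => [-> _|[r' ->]]; first by exists a.+1, b.+1, 0; split => //; right.
have [c [t [-> -> ht]]] := nruns_peel (~~ ~~ x) r'; rewrite ltnS negbK.
case: ht => [-> _|[t' ->]]; first by exists a.+1, b.+1, c.+1; rewrite cats0; split => //; left.
by have [d [u [_ -> _]]] := nruns_peel (~~ ~~ ~~ x) t'.
Qed.

Lemma size_runs3 a b c : size (runs3 a b c) = a + b + c.
Proof. by rewrite /runs3 !size_cat !size_nseq addnA. Qed.

Lemma alternating_runs3 a b c : 0 < a -> 0 < b \/ c = 0 ->
  alternating (runs3 a b c) = [&& a <= 1, b <= 1 & c <= 1].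
Proof.
have nseq2 (x : bool) n u v : sorted (fun a b => a != b) (u ++ nseq n x ++ v) -> n <= 1.
  move/cat_sorted2 => [_ /cat_sorted2[]].
  by case: n => [|[|n]] //=; rewrite eqxx.
move=> ha hbc; apply/idP/idP => [h|/and3P[ha1 hb1 hc1]].
  rewrite (nseq2 true a [::] _ h) (nseq2 false b _ _ h).
  apply: (nseq2 true c (nseq a true ++ nseq b false) [::]).
  by rewrite cats0 -catA.
by case: a b c ha hbc ha1 hb1 hc1 => [|[|]] // [|[|]] // [|[|]] // _ [].
Qed.

Lemma triv_equiv_1101_runs3 a b c : b == 1 -> a + c == 3 -> 0 < a -> 0 < c ->
  triv_equiv (runs3 a b c) [:: true; true; false; true].
Proof. by move=> /eqP -> /eqP; case: a => [|[|[|[|]]]] //; case: c => [|[|[|[|]]]]. Qed.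

Fixpoint words n : seq (seq bool) :=
  if n is n'.+1 then [seq true :: w | w <- words n'] ++ [seq false :: w | w <- words n']
  else [:: [::]].

Lemma mem_words n w : (w \in words n) = (size w == n).
Proof.
have inj b : injective (cons b : seq bool -> seq bool) by move=> ? ? [].
elim: n w => [|n IH] [|b w] //=; rewrite mem_cat ?eqSS.
  by apply/negbTE; rewrite negb_or; apply/andP; split; apply/negP => /mapP[].
rewrite -IH; case: b; rewrite (mem_map (inj _)) ?[X in _ || X](mem_map (inj _)).
  by rewrite orb_idr // => /mapP[].
by rewrite orb_idl // => /mapP[].
Qed.

Lemma M_eqI n p k w : size w = n -> cnt p w = k ->
  all (fun w => cnt p w <= k) (words n) -> M n p = k.
Proof.
move=> hw e /allP h; apply/eqP; rewrite eqn_leq -{2}e -{2}hw cnt_leq_M andbT.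
have [v hv <-] := M_attained n p.
by apply: h; rewrite mem_words hv.
Qed.

Lemma B_pred_max_1101 p : p \in [:: [:: true; true; false; true]; [:: true; false; true; true]] ->
  B 6 p (M 6 p - 1) != 0.
Proof.
rewrite !inE => /orP[]/eqP ->.
(* [111001] has [C(3,2) * 2 * 1 = 6] occurrences, the maximum by enumeration, and [110101] has
   [1 * 2 + 3 * 1 = 5]. The other word is the reverse case. *)
- rewrite (@M_eqI _ _ 6 [:: true; true; true; false; false; true]) //.
  by apply/B_neq0P; exists [:: true; true; false; true; false; true].
- rewrite (@M_eqI _ _ 6 [:: true; false; false; true; true; true]) //.
  by apply/B_neq0P; exists [:: true; false; true; false; true; true].
Qed.

(** Naming the conclusion lets it be carried over to the complement as a whole. *)
Definition gap_claim p :=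
  (alternating p -> forall n, 7 <= n -> ~ internal_zero p n) /\
  (~~ alternating p ->
     (forall n, size p + 3 <= n -> B n p (M n p - 1) = 0 /\ internal_zero p n) /\
     (B (size p + 2) p (M (size p + 2) p - 1) != 0 <->
        triv_equiv p [:: true; true; false; true])).

Lemma gap_claim_map_negb p : gap_claim (map negb p) -> gap_claim p.
Proof.
rewrite /gap_claim alternating_map_negb size_map triv_equiv_map_negb B_map_negb M_map_negb.
move=> [h1 h2]; split=> [halt n hn|hnalt].
  by rewrite -internal_zero_map_negb; exact: h1.
have [h3 h4] := h2 hnalt; split=> // n /h3.
by rewrite B_map_negb M_map_negb internal_zero_map_negb.
Qed.

Lemma gap_claim_runs3 a b c : 0 < a -> 0 < b \/ c = 0 -> gap_claim (runs3 a b c).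
Proof.
move=> ha hbc; split.
  rewrite alternating_runs3 // => /and3P[ha1 hb1 hc1] n hn.
  apply: downward_no_internal_zero.
  case: a b c ha hbc ha1 hb1 hc1 => [|[|]] // [|[|]] // [|[|]] // _ [] // _ _ _ _.
  - exact: downward_single.
  - exact: downward_10.
  - exact: downward_10.
  - exact: downward_101.
rewrite alternating_runs3 // => hnalt.
(* The exception at length 6 concerns three runs only, hence the conjunct [0 < c]. *)
have neq w : a + b + c + 2 <= size w -> ~~ [&& b == 1, a + c == 3, 0 < c & size w == 6] ->
    cnt (runs3 a b c) w + 1 <> M (size w) (runs3 a b c).
  move=> hn hexc; case: (posnP c) => [c0|cpos]; last first.
    have bpos : 0 < b by case: hbc => // c0; rewrite c0 in cpos.
    apply: cnt_runs3_neq_pred_max => //; first by lia.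
    by move: hexc; rewrite cpos.
  subst c; case: (posnP b) => [b0|bpos].
    subst b; rewrite /runs3 /= cats0.
    by apply: cnt_run1_neq_pred_max; lia.
  by apply: cnt_runs2_neq_pred_max => //; lia.
have [x [p ep]] : exists x p, runs3 a b c = x :: p.
  by case: (a) ha => // a' _; exists true; eexists; reflexivity.
have szp : a + b + c = (size p).+1 by rewrite -size_runs3 ep.
have Mgt n : a + b + c + 2 <= n -> 1 < M n (runs3 a b c).
  by move=> hn; rewrite ep; apply: M_ge2; lia.
have B0 n : a + b + c + 2 <= n -> ~~ [&& b == 1, a + c == 3, 0 < c & n == 6] ->
    B n (runs3 a b c) (M n (runs3 a b c) - 1) = 0.
  move=> hn hexc; apply/eqP; apply/negPn/negP => /B_neq0P[w hw e].
  have := Mgt n hn; rewrite -hw in hn hexc e *.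
  by have := neq w hn hexc; lia.
rewrite size_runs3; split=> [n hn|].
  have h : B n (runs3 a b c) (M n (runs3 a b c) - 1) = 0 by apply: B0; lia.
  by split=> //; move: h; rewrite ep; apply: internal_zeroI; lia.
split=> [hB|].
  have [|/B0 h] := boolP [&& b == 1, a + c == 3, 0 < c & a + b + c + 2 == 6].
    by case/and4P => *; apply: triv_equiv_1101_runs3.
  by rewrite h in hB.
rewrite -(size_runs3 a b c) ep /triv_equiv => hp.
(* The pattern begins with a one, which leaves [1101] and its reverse among the four equivalent
   words. *)
suff hp' : x :: p \in [:: [:: true; true; false; true]; [:: true; false; true; true]].
  have -> : size (x :: p) + 2 = 6 by move: hp'; rewrite !inE => /orP[]/eqP ->.
  exact: B_pred_max_1101.
have xt : x = true by move: ep; case: (a) ha => // a' _ [].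
move: hp; rewrite !inE => /or4P[]/eqP h.
- by rewrite -h.
- by rewrite -[x :: p]revK -h.
- by move: h; rewrite xt.
- by move: (congr1 rev h); rewrite revK xt.
Qed.

Theorem mainTheorem14 (p : seq bool) :
  nruns p <= 3 ->
  (alternating p -> forall n, 7 <= n -> ~ internal_zero p n) /\
  (~~ alternating p ->
     (forall n, size p + 3 <= n -> B n p (M n p - 1) = 0 /\ internal_zero p n) /\
     (B (size p + 2) p (M (size p + 2) p - 1) != 0 <->
        triv_equiv p [:: true; true; false; true])).
Proof.
rewrite -/(gap_claim p); case: p => [|x p] h.
  by split=> // _ n _; exact: no_internal_zero_nil.
have [a [b [c [ha hbc ->]]]] := nruns_leq3P h.
(* A pattern beginning with 0 is replaced by its complement. *)
case: x {h}; first exact: gap_claim_runs3.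
by apply: gap_claim_map_negb; rewrite !map_cat !map_nseq; exact: gap_claim_runs3.
Qed.
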